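(* Let $n_1,n_2\ge 0$ with $n_1+n_2=n\geq 1$ and let $\lambda=n_1-n_2$. Then there is an isomorphism of $b_n$-modules $$M_n(\lambda)\cong S(n_1,n_2)^{\circledast}.$$
   Context: Setting: $k$ is an algebraically closed field, $q\in k^\times$ with $q^4\neq 1$, $m$ is an integer, $\lambda_1=\frac{q^m}{q-q^{-1}}$, $\lambda_2=\frac{q^{-m}}{q-q^{-1}}$, and it is assumed that $\lambda_1\ne\lambda_2$ and $\lambda_1\neq q^2\lambda_2$. Write $[r]=\frac{q^r-q^{-r}}{q-q^{-1}}$. The blob algebra $b_n=b_n(q,m)$ is the unital $k$-algebra on generators $U_0,U_1,\dots,U_{n-1}$ with relations $U_iU_jU_i=U_i$ for $i,j\ge 1$, $|i-j|=1$; $U_i^2=-[2]U_i$ for $i\ge1$; $U_0^2=-[m]U_0$; $U_1U_0U_1=[m-1]U_1$; and $U_iU_j=U_jU_i$ for $|i-j|\ge 2$. Tensor space: let $V$ be a $k$-vector space with basis $v_1,v_2$. Define $R\in \operatorname{End}_k(V\otimes V)$ by $R(v_i\otimes v_i)=q\,v_i\otimes v_i$ ($i=1,2$), $R(v_2\otimes v_1)=v_1\otimes v_2$, $R(v_1\otimes v_2)=v_2\otimes v_1+(q-q^{-1})v_1\otimes v_2$. On $V^{\otimes n}$ let $T_{i+1}=\mathrm{Id}^{\otimes (i-1)}\otimes R\otimes \mathrm{Id}^{\otimes (n-i-1)}$ for $1\le i\le n-1$ (invertible). For $2\le j\le n$ let $S_j$ be the linear map which on a basis vector $v=v_{i_1}\otimes\cdots\otimes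 v_{i_n}$ is $S_j(v)=qv$ if $i_{j-1}=i_j$, and which interchanges the tensor factors in positions $j-1$ and $j$ if $i_{j-1}\ne i_j$. Let $\varpi(v_{i_1}\otimes\cdots\otimes v_{i_n})=\lambda_{i_1}\,v_{i_1}\otimes\cdots\otimes v_{i_n}$, $\theta=S_nS_{n-1}\cdots S_2$, $T_1=T_2^{-1}\cdots T_n^{-1}\theta\varpi$. Then $V^{\otimes n}$ is a $b_n$-module with $U_i$ ($i\ge1$) acting as $T_{i+1}-q$ and $U_0$ acting as $T_1-\lambda_1$. $M_n(\lambda)$ is the $b_n$-submodule of $V^{\otimes n}$ spanned by the $v_{i_1}\otimes\cdots\otimes v_{i_n}$ with $\#\{j: i_j=1\}-\#\{j:i_j=2\}=\lambda$. $H_k(n,2)$ is the unital $k$-algebra generated by $X,g_1,\dots,g_{n-1}$ with relations $g_ig_{i+1}g_i=g_{i+1}g_ig_{i+1}$; $g_ig_j=g_jg_i$ for $|i-j|\geq 2$; $g_1Xg_1X=Xg_1Xg_1$; $Xg_j=g_jX$ for $j>1$; $(g_i-q)(g_i+q^{-1})=0$; $(X-\lambda_1)(X-\lambda_2)=0$. Put $X_1=X$ and $X_i=g_{i-1}X_{i-1}g_{i-1}$ for $2\le i\le n$. The Specht module $S(n_1,n_2)$ for $H_k(n,2)$ is the cell module of Dipper–James–Mathas attached to the two-line bipartition $(\tau,\mu)=((n_1),(n_2))$. Explicitly, a standard bitableau of shape $((n_1),(n_2))$ is a pair $t=(t^1,t^2)$ of one-row tableaux of lengths $n_1$, $n_2$,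 together containing each of $1,\dots,n$ exactly once, with entries increasing along each row. $S(n_1,n_2)$ has $k$-basis $\{[t]\}$ indexed by the standard bitableaux, and $g_i$ acts by: $g_i[t]=\sigma_i[t]$ if $i\in t^1$, $i+1\in t^2$; $g_i[t]=\sigma_i[t]+(q-q^{-1})[t]$ if $i+1\in t^1$, $i\in t^2$; $g_i[t]=q[t]$ if $i,i+1$ lie in the same component; here $\sigma_i[t]$ is the basis element of the bitableau obtained from $t$ by interchanging $i$ and $i+1$. If $t^{\tau,\mu}$ is the standard bitableau with $1,\dots,n_1$ in the first component and $n_1+1,\dots,n$ in the second, then $X_i[t^{\tau,\mu}]=\lambda_1q^{2(i-1)}[t^{\tau,\mu}]$ for $1\le i\le n_1$ and $X_i[t^{\tau,\mu}]=\lambda_2q^{2(i-n_1-1)}[t^{\tau,\mu}]$ for $n_1+1\le i\le n$. These rules, together with the relations of $H_k(n,2)$, determine the module completely. It is a $b_n$-module with $U_i$ ($i\ge1$) acting as $g_i-q$ and $U_0$ acting as $X-\lambda_1$. Contragredient dual: for a module $M$, $M^{\circledast}=\operatorname{Hom}_k(M,k)$ with action $(hf)(x)=f(h^*x)$, where $*$ is the anti-involution of $H_k(n,2)$ with $g_i^*=g_i$, $X^*=X$ (equivalently, the anti-involution of $b_n$ fixing every $U_i$). *)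

(* Defs.v *)
From HB Require Import structures.
From mathcomp Require Import all_boot all_order all_algebra.
From mathcomp Require Import zify.

Set Implicit Arguments.
Unset Strict Implicit.
Unset Printing Implicit Defensive.

Import Order.TTheory GRing.Theory Num.Theory.
Local Open Scope ring_scope.

Definition qint (k : fieldType) (q : k) (r : int) : k :=
  (q ^ r - q ^ (- r)) / (q - q^-1).

Definition lambda1 (k : fieldType) (q : k) (m : int) : k := q ^ m / (q - q^-1).
Definition lambda2 (k : fieldType) (q : k) (m : int) : k :=
  q ^ (- m) / (q - q^-1).

(*  A module over a [k]-algebra presented by generators and relations is a
    [k]-vector space with one endomorphism per generator, these endomorphisms
    satisfying the defining relations; a linear map is a module morphism iff it
    commutes with the generators.  Families of generators are indexed by [nat];
    only the values at the indices of actual generators ([i < n] for [U],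
    [0 < i < n] for [g]) are ever used. *)

Record is_blob_module (k : fieldType) (n : nat) (q : k) (m : int)
    (W : vectType k) (U : nat -> 'End(W)) : Prop := {
  blob_UUU : forall i j, (0 < i < n)%N -> (0 < j < n)%N ->
    (i.+1 == j) || (j.+1 == i) -> (U i \o U j \o U i = U i)%VF;
  blob_UU : forall i, (0 < i < n)%N -> (U i \o U i)%VF = - qint q 2 *: U i;
  blob_U0U0 : (0 < n)%N -> (U 0 \o U 0)%VF = - qint q m *: U 0;
  blob_U1U0U1 : (1 < n)%N -> (U 1 \o U 0 \o U 1)%VF = qint q (m - 1) *: U 1;
  blob_comm : forall i j, (i < n)%N -> (j < n)%N ->
    (i.+2 <= j)%N || (j.+2 <= i)%N -> (U i \o U j = U j \o U i)%VF
}.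

Record is_hecke_module (k : fieldType) (n : nat) (q : k) (m : int)
    (W : vectType k) (X : 'End(W)) (g : nat -> 'End(W)) : Prop := {
  hecke_braid : forall i, (0 < i)%N -> (i.+1 < n)%N ->
    (g i \o g i.+1 \o g i = g i.+1 \o g i \o g i.+1)%VF;
  hecke_comm : forall i j, (0 < i < n)%N -> (0 < j < n)%N ->
    (i.+2 <= j)%N || (j.+2 <= i)%N -> (g i \o g j = g j \o g i)%VF;
  hecke_braidX : (1 < n)%N ->
    (g 1 \o X \o g 1 \o X = X \o g 1 \o X \o g 1)%VF;
  hecke_commX : forall j, (1 < j < n)%N -> (X \o g j = g j \o X)%VF;
  hecke_quad : forall i, (0 < i < n)%N ->
    ((g i - q *: \1) \o (g i + q^-1 *: \1))%VF = 0;
  hecke_quadX :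
    ((X - lambda1 q m *: \1) \o (X - lambda2 q m *: \1))%VF = 0
}.

(* Jucys-Murphy elements: X_1 = X and X_(i+1) = g_i X_i g_i; the index 0 is
   unused. *)
Fixpoint jucys_murphy (k : fieldType) (W : vectType k) (X : 'End(W))
    (g : nat -> 'End(W)) (i : nat) : 'End(W) :=
  match i with
  | j.+1 => if j is 0 then X else (g j \o jucys_murphy X g j \o g j)%VF
  | 0 => X
  end.

Definition blob_isomorphic (k : fieldType) (n : nat) (q : k) (m : int)
    (W1 W2 : vectType k) (U1 : nat -> 'End(W1)) (U2 : nat -> 'End(W2)) : Prop :=
  [/\ is_blob_module n q m U1, is_blob_module n q m U2
    & exists f : 'Hom(W1, W2),
        bijective f /\ forall i, (i < n)%N -> (f \o U1 i = U2 i \o f)%VF].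

Definition is_stable (k : fieldType) (n : nat) (W : vectType k)
    (U : nat -> 'End(W)) (M : {vspace W}) : Prop :=
  forall i, (i < n)%N -> (U i @: M <= M)%VS.

(* The action on a subspace; it is the restriction of [U] when the subspace is
   stable under [U]. *)
Definition sub_action (k : fieldType) (W : vectType k) (U : nat -> 'End(W))
    (M : {vspace W}) (i : nat) : 'End(subvs_of M) :=
  linfun (fun x : subvs_of M => vsproj M (U i (vsval x))).

(* The contragredient action on Hom_k(W, k): the anti-involution fixes every
   generator, so [U i] sends [f] to [x |-> f (U i x)]. *)
Definition dual_action (k : fieldType) (W : vectType k) (U : nat -> 'End(W))
    (i : nat) : 'End('Hom(W, k^o)) :=
  linfun (fun f : 'Hom(W, k^o) => (f \o U i)%VF).

Lemma sub_actionE (k : fieldType) (W : vectType k) (U : nat -> 'End(W))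
  (M : {vspace W}) (i : nat) (x : subvs_of M) :
  (U i @: M <= M)%VS -> vsval (sub_action U M i x) = U i (vsval x).
Proof.
move=> sM; rewrite /sub_action.
rewrite (lfunE (vsproj M \o U i \o vsval : {linear subvs_of M -> _})) /=.
by rewrite vsprojK //; apply: (subvP sM); apply: memv_img; apply: subvsP.
Qed.

Lemma dual_actionE (k : fieldType) (W : vectType k) (U : nat -> 'End(W))
  (i : nat) (f : 'Hom(W, k^o)) (x : W) : dual_action U i f x = f (U i x).
Proof.
have lf : linear (fun f : 'Hom(W, k^o) => (f \o U i)%VF).
  by move=> a u v; rewrite comp_lfunDl comp_lfunZl.
pose fL := GRing.isLinear.Build _ _ _ _ _ lf.
pose F : {linear 'Hom(W, k^o) -> 'Hom(W, k^o)} := HB.pack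
  (fun f : 'Hom(W, k^o) => (f \o U i)%VF) fL.
by rewrite /dual_action (lfunE F) /= comp_lfunE.
Qed.

Definition free_space (k : fieldType) (T : finType) : vectType k :=
  {ffun T -> k^o}.

Definition bvec (k : fieldType) (T : finType) (t : T) : free_space k T :=
  [ffun s => (s == t)%:R].

Definition lin_ext (k : fieldType) (T : finType) (W : vectType k)
    (f : T -> W) : 'Hom(free_space k T, W) :=
  linfun (fun x : free_space k T => \sum_(t : T) (x t : k) *: f t).

Lemma lin_ext_bvec (k : fieldType) (T : finType) (W : vectType k)
  (f : T -> W) (t : T) : lin_ext f (bvec k t) = f t.
Proof.
have lf : linear (fun x : free_space k T => \sum_(t : T) (x t : k) *: f t).
  move=> a u v; rewrite scaler_sumr -big_split /=; apply: eq_bigr => s _.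
  by rewrite !ffunE scalerDl scalerA.
pose fL := GRing.isLinear.Build _ _ _ _ _ lf.
pose F : {linear free_space k T -> W} := HB.pack
  (fun x : free_space k T => \sum_(t : T) (x t : k) *: f t) fL.
rewrite /lin_ext (lfunE F) /= (bigD1 t) //= !ffunE eqxx scale1r.
by rewrite big1 ?addr0 // => s ns; rewrite !ffunE (negbTE ns) scale0r.
Qed.

(*  The basis vector v_(i_1) (x) ... (x) v_(i_n) is encoded by the word
    i_1 ... i_n over [bool], where [false] stands for the index 1 and [true]
    for the index 2.  Positions in words are counted from 1. *)

Definition word (n : nat) : finType := n.-tuple bool.

Definition letter (n : nat) (w : word n) (j : nat) : bool := nth false w j.-1.

Definition put2 (n : nat) (w : word n) (j : nat) (a b : bool) : word n :=
  [tuple (if i.+1 == j.-1 then a else if i.+1 == j then b else tnth w i)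
  | i < n].

Definition tensor_space (k : fieldType) (n : nat) : vectType k :=
  free_space k (word n).

Definition Rmap (k : fieldType) (q : k) :
    'End(free_space k (bool * bool)%type) :=
  lin_ext (fun ab => match ab with
    | (true, false) => bvec k (false, true)
    | (false, true) =>
        bvec k (true, false) + (q - q^-1) *: bvec k (false, true)
    | _ => q *: bvec k ab
    end).

(* [Top n q j] is T_j = Id (x) R (x) Id for 2 <= j <= n, with [R] acting on the
   tensor factors in positions j-1 and j. *)
Definition Top (k : fieldType) (n : nat) (q : k) (j : nat) :
    'End(tensor_space k n) :=
  lin_ext (fun w : word n =>
    \sum_(ab : bool * bool)
      (Rmap q (bvec k (letter w j.-1, letter w j)) ab : k)
        *: bvec k (put2 w j ab.1 ab.2)).

Definition Sop (k : fieldType) (n : nat) (q : k) (j : nat) :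
    'End(tensor_space k n) :=
  lin_ext (fun w : word n =>
    if letter w j.-1 == letter w j then q *: bvec k w
    else bvec k (put2 w j (letter w j) (letter w j.-1))).

Definition varpi (k : fieldType) (n : nat) (q : k) (m : int) :
    'End(tensor_space k n) :=
  lin_ext (fun w : word n =>
    (if letter w 1 then lambda2 q m else lambda1 q m) *: bvec k w).

Definition theta (k : fieldType) (n : nat) (q : k) : 'End(tensor_space k n) :=
  (\big[(@comp_lfun _ _ _ _)/(\1%VF)]_(j <- rev (index_iota 2 n.+1)) Sop n q j).

(* T_1 = T_2^-1 ... T_n^-1 theta varpi.  [f^-1] is total on linear maps; it is
   the two-sided inverse when [f] is bijective, as T_2, ..., T_n are. *)
Definition T1op (k : fieldType) (n : nat) (q : k) (m : int) :
    'End(tensor_space k n) :=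
  ((\big[(@comp_lfun _ _ _ _)/(\1%VF)]_(2 <= j < n.+1) (Top n q j)^-1)
     \o theta n q \o varpi n q m)%VF.

Definition tensor_action (k : fieldType) (n : nat) (q : k) (m : int)
    (i : nat) : 'End(tensor_space k n) :=
  if i is 0 then T1op n q m - lambda1 q m *: \1%VF
  else Top n q i.+1 - q *: \1%VF.

Definition weight (n : nat) (w : word n) : int :=
  (count_mem false w)%:Z - (count_mem true w)%:Z.

Definition weight_space (k : fieldType) (n : nat) (l : int) :
    {vspace tensor_space k n} :=
  <<[seq bvec k w | w <- enum (word n) & weight w == l]>>%VS.

(*  Entries live in ['I_(n1 + n2).+1] only to make the type finite; they are
    1, ..., n1 + n2. *)

Definition is_standard (n1 n2 : nat)
    (t : n1.-tuple 'I_(n1 + n2).+1 * n2.-tuple 'I_(n1 + n2).+1) : bool :=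
  [&& sorted ltn (map val t.1), sorted ltn (map val t.2)
    & perm_eq (map val (t.1 ++ t.2)) (iota 1 (n1 + n2))].

Definition bitableau (n1 n2 : nat) : finType :=
  {t : n1.-tuple 'I_(n1 + n2).+1 * n2.-tuple 'I_(n1 + n2).+1 | is_standard t}.

Definition row1 (n1 n2 : nat) (t : bitableau n1 n2) : seq nat :=
  map val (val t).1.
Definition row2 (n1 n2 : nat) (t : bitableau n1 n2) : seq nat :=
  map val (val t).2.

Lemma is_standard_initial (n1 n2 : nat) :
  @is_standard n1 n2 ([tuple inord i.+1 | i < n1],
                      [tuple inord (n1 + i).+1 | i < n2]).
Proof.
have E1 : map val [tuple (inord i.+1 : 'I_(n1 + n2).+1) | i < n1] = iota 1 n1.
  rewrite /= -map_comp -[1%N]addn0 iotaDl -val_enum_ord -map_comp.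
  apply: eq_map => i /=; rewrite inordK ?add1n //.
  by rewrite ltnS; apply: leq_trans (ltn_ord i) (leq_addr _ _).
have E2 : map val [tuple (inord (n1 + i).+1 : 'I_(n1 + n2).+1) | i < n2]
    = iota n1.+1 n2.
  rewrite /= -map_comp -[n1.+1]addn0 iotaDl -val_enum_ord -map_comp.
  apply: eq_map => i /=; rewrite inordK ?addSn //.
  by rewrite ltnS ltn_add2l.
by rewrite /is_standard /= map_cat E1 E2 !iota_ltn_sorted -add1n -iotaD perm_refl.
Qed.

(* t^(tau, mu) *)
Definition initial_bitableau (n1 n2 : nat) : bitableau n1 n2 :=
  Sub _ (is_standard_initial n1 n2).

Definition swap_entry (N i : nat) (x : 'I_N.+1) : 'I_N.+1 :=
  if val x == i then inord i.+1 else if val x == i.+1 then inord i else x.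

(* sigma_i t; see [val_swap_bitableau] for the only case in which it is used. *)
Definition swap_bitableau (n1 n2 i : nat) (t : bitableau n1 n2) :
    bitableau n1 n2 :=
  insubd t ([tuple of map (@swap_entry _ i) (val t).1],
            [tuple of map (@swap_entry _ i) (val t).2]).

Definition swapn (i x : nat) : nat :=
  if x == i then i.+1 else if x == i.+1 then i else x.

Lemma swapn_lt (i x y : nat) :
  (x < y)%N -> ~ (x = i /\ y = i.+1) -> (swapn i x < swapn i y)%N.
Proof. by rewrite /swapn; do !case: eqP; lia. Qed.

Lemma swapnK (i : nat) : involutive (swapn i).
Proof. by move=> x; rewrite /swapn; do !case: eqP; lia. Qed.

Lemma swapn_bound (i x N : nat) : (0 < i < N)%N ->
  (0 < swapn i x <= N)%N = (0 < x <= N)%N.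
Proof. by rewrite /swapn; do !case: eqP; lia. Qed.

Lemma val_swap_bitableau (n1 n2 i : nat) (t : bitableau n1 n2) :
  (0 < i < n1 + n2)%N -> (i \in row1 t) != (i.+1 \in row1 t) ->
  val (swap_bitableau i t)
    = ([tuple of map (@swap_entry _ i) (val t).1],
       [tuple of map (@swap_entry _ i) (val t).2]).
Proof.
move=> iB hsep; have /andP[i0 iN] := iB.
rewrite /swap_bitableau val_insubd ifT //.
pose s := swapn i.
have Es (r : seq 'I_(n1 + n2).+1) :
    map val (map (@swap_entry _ i) r) = map s (map val r).
  rewrite -!map_comp; apply: eq_map => x /=; rewrite /swap_entry /s /swapn.
  by case: ifP => _ //=; [|case: ifP => _ //=]; rewrite inordK // ltnS // ltnW.
have /and3P[st1 st2 pt] := valP t.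
have ut : uniq (row1 t ++ row2 t).
  by rewrite /row1 /row2 -map_cat (perm_uniq pt) iota_uniq.
have mt x : (x \in row1 t ++ row2 t) = (0 < x <= n1 + n2)%N.
  by rewrite /row1 /row2 -map_cat (perm_mem pt) mem_iota add1n ltnS.
have srt (r : seq nat) : sorted ltn r -> ~~ ((i \in r) && (i.+1 \in r)) ->
    sorted ltn (map s r).
  move=> sr /negP nb; apply: (@homo_sorted_in _ _ (mem r) s ltn ltn) => //.
  move=> x y xr yr /= xy; apply: swapn_lt => // -[ex ey].
  by case: nb; rewrite -ey -ex; apply/andP.
rewrite /is_standard /= map_cat !Es.
have dis x : ~~ ((x \in row1 t) && (x \in row2 t)).
  move: ut; rewrite cat_uniq => /and3P[_ /hasPn h _].
  by apply/negP => /andP[x1 /h]; rewrite /= x1.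
have mi := mt i; have mi1 := mt i.+1; rewrite !mem_cat in mi mi1.
have di := dis i; have di1 := dis i.+1.
have [ei ei1] : (i \in row1 t) || (i \in row2 t) /\
    (i.+1 \in row1 t) || (i.+1 \in row2 t).
  by rewrite mi mi1 i0 iN (ltnW iN).
apply/and3P; split.
- by apply: srt => //; move: hsep; case: (i \in row1 t); case: (i.+1 \in _).
- apply: srt => //; move: hsep di di1 ei ei1; rewrite /row1 /row2.
  by do 4!case: (_ \in _).
- rewrite -map_cat; have ss : involutive s := @swapnK i.
  apply: uniq_perm; rewrite ?iota_uniq //.
    by rewrite (map_inj_uniq (inv_inj ss)).
  move=> x; rewrite -[x in LHS]ss (mem_map (inv_inj ss)) mt mem_iota.
  by rewrite add1n ltnS swapn_bound.
Qed.

Definition specht_space (k : fieldType) (n1 n2 : nat) : vectType k :=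
  free_space k (bitableau n1 n2).

(* Every i with 1 <= i <= n1 + n2 lies in exactly one of the two rows, so
   "i in the second row" is rendered as "i not in the first row". *)
Definition specht_g (k : fieldType) (n1 n2 : nat) (q : k) (i : nat) :
    'End(specht_space k n1 n2) :=
  lin_ext (fun t : bitableau n1 n2 =>
    if (i \in row1 t) == (i.+1 \in row1 t) then q *: bvec k t
    else if i \in row1 t then bvec k (swap_bitableau i t)
    else bvec k (swap_bitableau i t) + (q - q^-1) *: bvec k t).

(* [X] completes the operators g_i to the structure of the Specht module: this
   determines [X]. *)
Definition is_specht (k : fieldType) (n1 n2 : nat) (q : k) (m : int)
    (X : 'End(specht_space k n1 n2)) : Prop :=
  let g := specht_g n1 n2 q in
  let t0 := bvec k (initial_bitableau n1 n2) in
  [/\ is_hecke_module (n1 + n2) q m X g,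
      forall i, (1 <= i <= n1)%N ->
        jucys_murphy X g i t0 = (lambda1 q m * q ^+ (2 * (i - 1))) *: t0
    & forall i, (n1 + 1 <= i <= n1 + n2)%N ->
        jucys_murphy X g i t0 = (lambda2 q m * q ^+ (2 * (i - n1 - 1))) *: t0].

Definition specht_action (k : fieldType) (n1 n2 : nat) (q : k) (m : int)
    (X : 'End(specht_space k n1 n2)) (i : nat) : 'End(specht_space k n1 n2) :=
  if i is 0 then X - lambda1 q m *: \1%VF
  else specht_g n1 n2 q i - q *: \1%VF.

(* Main.v *)
Require Import Defs.
From mathcomp Require Import all_boot all_order all_algebra.
From HB Require Import structures.
From mathcomp Require Import zify ring.
From Stdlib Require Import FunctionalExtensionality.
Import GRing.Theory.
Import Defs.
Local Open Scope ring_scope.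

Set Implicit Arguments.
Unset Strict Implicit.
Unset Printing Implicit Defensive.

(** Put c = q - q^-1.  Both modules are studied through functions on words in
    the letters 1 = [false] and 2 = [true].  On the tensor side, the function x
    stands for the vector whose coefficient at v_w is x w.  On the dual side, a
    standard bitableau is read as the word having a 1 at the entries of its
    first row, and y stands for the linear form on S(n1, n2) whose value at
    the bitableau of word w is y w.  Splitting off the first letter of the words
    makes a function x into a pair (x_1, x_2), and all operators are described
    by their action on such pairs.

    Let E_p be the raising operator of quantum sl_2 with parameter p, acting on
    tensors:  E_p (x_1, x_2) = (p E_p x_1 + x_2, p^-1 E_p x_2).  Moving the
    first tensor factor to the end by theta and bringing it back by the inverses
    of the T_i shows ([coef_T1op]) that T_1 is triangular,

      T_1 (x_1, x_2) = (lambda_1 x_1, lambda_2 x_2 - c lambda_1 E_q x_1).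

    On the Specht side, X is known on the two words 1^n1 2^n2 and
    2 1^n1 2^(n2 - 1): on the first one by the rule for X_1, and on the second
    one because X_(n1+1) = g_n1 ... g_1 X g_1 ... g_n1 is known on 1^n1 2^n2.
    As X commutes with g_2, ..., g_(n-1), and these carry the two words to all
    the others, X acts on linear forms ([functional_X]) by

      X (y_1, y_2) = (lambda_1 y_1, lambda_2 (y_2 - c E_(1/q) y_1)).

    The operator T_(i+1) exchanges two neighbouring letters 1 2 and 2 1 by the
    matrix with rows (c, 1), (1, 0), while g_i does it by the one with rows
    (0, 1), (1, c): the first is the inverse of the second with q replaced by
    q^-1.  The two are therefore intertwined by a bar involution, as is
    usual for quantum groups; here it is given by the recursion

      P (x_1, x_2) = (P x_1, P x_2 + c P E_q x_1).

    P is unitriangular, and its inverse is the same operator for q^-1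
    ([transitionK]).  It carries E_q to E_(1/q) ([transition_raising]), T_(i+1)
    to g_i ([transition_exch]), and the two displayed formulas show that it
    carries T_1 to X ([transition_T1]).  So P induces the isomorphism.  The
    relations of the blob algebra are read off the explicit operators on the
    dual Specht module, and M_n(lambda) inherits them along the isomorphism. *)

(** * Operators on functions on words *)

Section Operators.
Variables (k : fieldType) (q : k).
Implicit Types (p r : k) (x y z : seq bool -> k) (u v w : seq bool).

(** The generator E of quantum sl_2, which turns a letter 2 into a 1, acting on
    tensors through the coproduct: [p] is its Cartan weight on v_1. *)
Fixpoint raising p x w : k :=
  match w with
  | [::] => 0
  | false :: u => p * raising p (fun v => x (false :: v)) u + x (true :: u)
  | true :: u => p^-1 * raising p (fun v => x (true :: v)) u
  end.

(** The words on which the swap at positions [i], [i + 1] (counted from 0) makes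
    no sense are left alone, so that [swapl i] is an involution. *)
Fixpoint swapl i w : seq bool :=
  match i, w with
  | 0, a :: b :: u => b :: a :: u
  | i'.+1, a :: u => a :: swapl i' u
  | _, _ => w
  end.

(** The common form of T_j, S_j and of the transpose of g_i: [d a] is the
    diagonal coefficient when the letters at positions [i], [i + 1] are [a] and
    the other one.  On words that are too short the value is that on a pair of
    equal letters, which keeps the quadratic relation valid everywhere. *)
Fixpoint exch (d : bool -> k) i x w : k :=
  match i, w with
  | 0, a :: b :: u => if a == b then q * x w else x (b :: a :: u) + d a * x w
  | i'.+1, a :: u => exch d i' (fun v => x (a :: v)) u
  | _, _ => q * x w
  end.

(** [mix false] makes [exch] the operator T_(i+2) of tensor space, and
    [mix true] makes it the generator g_(i+1) of the Hecke algebra, acting on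
    linear forms on the Specht module. *)
Definition mix (s a : bool) : k := if a == s then q - q^-1 else 0.

(** The bar involution P for the parameter [r]. *)
Fixpoint transition r x w : k :=
  match w with
  | [::] => x [::]
  | false :: u => transition r (fun v => x (false :: v)) u
  | true :: u => transition r (fun v => x (true :: v)) u
      + (r - r^-1) * transition r (raising r (fun v => x (false :: v))) u
  end.

(** The actions of T_1 on tensors and of X on linear forms on the Specht
    module, [l1] and [l2] being their eigenvalues. *)
Definition tensor_T1 (l1 l2 : k) x w : k :=
  match w with
  | [::] => x [::]
  | false :: u => l1 * x w
  | true :: u =>
      l2 * x w - (q - q^-1) * (l1 * raising q (fun v => x (false :: v)) u)
  end.

Definition specht_X (l1 l2 : k) y w : k :=
  match w with
  | [::] => y [::]
  | false :: u => l1 * y w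
  | true :: u =>
      l2 * (y w - (q - q^-1) * raising q^-1 (fun v => y (false :: v)) u)
  end.

(** The generators of the blob algebra, acting on linear forms on the Specht
    module. *)
Definition blob_gen (l1 l2 : k) i y : seq bool -> k :=
  if i is i'.+1 then fun w => exch (mix true) i' y w - q * y w
  else fun w => specht_X l1 l2 y w - l1 * y w.

Lemma raisingD p x y :
  raising p (fun v => x v + y v) = fun u => raising p x u + raising p y u.
Proof.
apply: functional_extensionality => u.
elim: u x y => [|[] u IH] x y /=; first by rewrite addr0.
  by rewrite IH mulrDr.
by rewrite IH mulrDr addrACA.
Qed.

Lemma raisingZ p a x :
  raising p (fun v => a * x v) = fun u => a * raising p x u.
Proof.
apply: functional_extensionality => u.
by elim: u x => [|[] u IH] x /=; rewrite ?mulr0 // IH; ring.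
Qed.

Lemma raisingN p x : raising p (fun v => - x v) = fun u => - raising p x u.
Proof.
have -> : (fun v => - x v) = fun v => (-1) * x v.
  by apply: functional_extensionality => v; rewrite mulN1r.
by rewrite raisingZ; apply: functional_extensionality => u; rewrite mulN1r.
Qed.

Definition raisingE := (raisingD, raisingZ, raisingN).

Lemma transitionD r x y :
  transition r (fun v => x v + y v) =
  fun u => transition r x u + transition r y u.
Proof.
apply: functional_extensionality => u.
by elim: u x y => [|[] u IH] x y //=; rewrite ?raisingE !IH; ring.
Qed.

Lemma transitionZ r a x :
  transition r (fun v => a * x v) = fun u => a * transition r x u.
Proof.
apply: functional_extensionality => u.
by elim: u x => [|[] u IH] x //=; rewrite ?raisingE !IH; ring.
Qed.

Lemma transitionN r x :
  transition r (fun v => - x v) = fun u => - transition r x u.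
Proof.
have -> : (fun v => - x v) = fun v => (-1) * x v.
  by apply: functional_extensionality => v; rewrite mulN1r.
by rewrite transitionZ; apply: functional_extensionality => u; rewrite mulN1r.
Qed.

Definition transitionE := (transitionD, transitionZ, transitionN).

Lemma exchD d i x y :
  exch d i (fun v => x v + y v) = fun u => exch d i x u + exch d i y u.
Proof.
apply: functional_extensionality => u.
elim: i u x y => [|i IH] [|a u] x y /=; rewrite ?mulrDr ?IH //.
case: u => [|b u]; rewrite ?mulrDr //.
by case: ifP => _; rewrite ?mulrDr // addrACA.
Qed.

Lemma exchZ d i e x : exch d i (fun v => e * x v) = fun u => e * exch d i x u.
Proof.
apply: functional_extensionality => u.
elim: i u x => [|i IH] [|a u] x /=; rewrite ?(mulrCA q) ?IH //.
by case: u => [|b u]; [ring | case: ifP => _; ring].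
Qed.

Lemma exchN d i x : exch d i (fun v => - x v) = fun u => - exch d i x u.
Proof.
have -> : (fun v => - x v) = fun v => (-1) * x v.
  by apply: functional_extensionality => v; rewrite mulN1r.
by rewrite exchZ; apply: functional_extensionality => u; rewrite mulN1r.
Qed.

Definition exchE := (exchD, exchZ, exchN).

Lemma specht_XD l1 l2 x y :
  specht_X l1 l2 (fun v => x v + y v) =
  fun u => specht_X l1 l2 x u + specht_X l1 l2 y u.
Proof.
by apply: functional_extensionality => -[|[] u] //=; rewrite ?raisingE; ring.
Qed.

Lemma specht_XZ l1 l2 a x :
  specht_X l1 l2 (fun v => a * x v) = fun u => a * specht_X l1 l2 x u.
Proof.
by apply: functional_extensionality => -[|[] u] //=; rewrite ?raisingE; ring.
Qed.

Lemma specht_XN l1 l2 x :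
  specht_X l1 l2 (fun v => - x v) = fun u => - specht_X l1 l2 x u.
Proof.
by apply: functional_extensionality => -[|[] u] //=; rewrite ?raisingE; ring.
Qed.

Definition specht_XE := (specht_XD, specht_XZ, specht_XN).

Lemma exchP d i x w : (i.+1 < size w)%N ->
  exch d i x w =
  if nth false w i == nth false w i.+1 then q * x w
  else x (swapl i w) + d (nth false w i) * x w.
Proof.
elim: i w x => [|i IH] [|a w] x //= sw; last exact: IH.
by case: w sw.
Qed.

Lemma exch_comm d i j x : (i.+1 < j)%N ->
  exch d i (exch d j x) = exch d j (exch d i x).
Proof.
move=> ij; apply: functional_extensionality => w.
elim: i j ij w x => [|i IH] [|j] // ij [|a w] x //=; last exact: IH.
case: j ij => // j _; case: w => [|b w] //=.
by case: ifP => _; rewrite ?exchD !exchZ.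
Qed.

Lemma raising_nseq_true p x b : raising p x (nseq b true) = 0.
Proof. by elim: b x => //= b IH x; rewrite IH mulr0. Qed.

(** * Commutation and intertwining *)

(** E commutes with the braiding because the braiding is an endomorphism of the
    tensor square of the natural module; the two conditions on [d] are what this
    requires on the words 1 1, 1 2 and 2 1.  They hold for [mix false] with
    [p = q], and for [mix true] with [p = q^-1]. *)
Lemma raising_exch p d i x :
  p != 0 -> d false = q - p^-1 -> d true = q - p ->
  raising p (exch d i x) = exch d i (raising p x).
Proof.
move=> p0 d0 d1; apply: functional_extensionality => w.
elim: i w x => [|i IH] w x; last first.
  by case: w => [|[] w] /=; rewrite ?mulr0 // ?exchD ?exchZ -?IH.
by case: w => [|[] [|[] w]] /=; rewrite ?mulr0 ?raisingE ?d0 ?d1 /=; field.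
Qed.

Hypothesis q0 : q != 0.

Lemma exch_quad s i x :
  exch (mix s) i (exch (mix s) i x) =
  fun w => x w + (q - q^-1) * exch (mix s) i x w.
Proof.
apply: functional_extensionality => w.
elim: i w x => [|i IH] [|a w] x /=; try by [field | exact: IH].
case: w => [|b w]; first by field.
by case: s; case: a; case: b; rewrite /mix /=; field.
Qed.

Lemma foldr_exch_surj s (r : seq nat) y :
  exists z, foldr (exch (mix s)) z r = y.
Proof.
elim: r y => [|i r IH] y; first by exists y.
(* By the quadratic relation, the inverse of g is g - c. *)
have [z zE] := IH (fun w => exch (mix s) i y w + (- (q - q^-1)) * y w).
exists z; rewrite /= zE exchD exchZ exch_quad.
by apply: functional_extensionality => w; ring.
Qed.

(** The coefficient r - r^-1 in [transition] is the difference between the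
    weights r and r^-1 with which E passes a first letter 1 before and after
    the parameter is inverted. *)
Lemma transition_raising r x : r != 0 ->
  transition r (raising r x) = raising r^-1 (transition r x).
Proof.
move=> r0; apply: functional_extensionality => w.
elim: w x => [|[] w IH] x //=; rewrite !(transitionE, raisingE) !IH /=.
  by rewrite invrK; field.
by field.
Qed.

(** The correction terms of the two recursions have opposite coefficients, and
    they cancel once E has been moved across [transition r]. *)
Lemma transitionK r x : r != 0 -> transition r^-1 (transition r x) = x.
Proof.
move=> r0; apply: functional_extensionality => w.
elim: w x => [|[] w IH] x //=.
have comm y : raising r^-1 (transition r y) = transition r (raising r y).
  by rewrite transition_raising.
by rewrite !transitionE [raising r^-1 _]comm invrK !IH; ring.
Qed.

(** At position 0 both sides are computed on the four pairs of letters, the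
    identities between coefficients reducing to c^2 + c / q = c q; at later
    positions, the term with E is dealt with by [raising_exch]. *)
Lemma transition_exch i x :
  transition q (exch (mix false) i x) = exch (mix true) i (transition q x).
Proof.
apply: functional_extensionality => w.
elim: i w x => [|i IH] w x; last first.
  case: w => [|[] w] //=; rewrite ?IH //.
  by rewrite [raising q _]raising_exch ?/mix ?subrr // IH exchD exchZ.
case: w => [|[] [|[] w]] //=; rewrite ?(raisingE, transitionE) /mix /=;
  by field.
Qed.

(** Here the correction term of T_1, which contains E, cancels the one of the
    bar involution. *)
Lemma transition_T1 l1 l2 x :
  transition q (tensor_T1 l1 l2 x) = specht_X l1 l2 (transition q x).
Proof.
apply: functional_extensionality => -[|[] w] //=; last by rewrite transitionZ.
by rewrite !(transitionE, raisingE) !transition_raising //; ring.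
Qed.

Lemma specht_X_exch l1 l2 i y :
  specht_X l1 l2 (exch (mix true) i.+1 y) =
  exch (mix true) i.+1 (specht_X l1 l2 y).
Proof.
apply: functional_extensionality => -[|[] w] //=; last by rewrite exchZ.
rewrite exchZ exchD (_ : (fun u => - _) = fun u => (-1) * ((q - q^-1) *
  raising q^-1 (fun v => y (false :: v)) u)) ?exchZ.
  rewrite [raising _ _]raising_exch /mix ?subrr ?invr_eq0 ?invrK //; ring.
by apply: functional_extensionality => u; rewrite mulN1r.
Qed.

(** * The relations of the blob algebra *)

Lemma blob_gen_sqr l1 l2 i y w :
  blob_gen l1 l2 i.+1 (blob_gen l1 l2 i.+1 y) w =
  - (q + q^-1) * blob_gen l1 l2 i.+1 y w.
Proof. by rewrite /= !exchE exch_quad; field. Qed.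

(** Only the three letters at positions [i], [i + 1], [i + 2] matter, and the
    eight triples of letters are checked directly: the q-antisymmetrizer on
    three factors vanishes since there are only two letters. *)
Lemma blob_gen_TL l1 l2 i y w : (i.+2 < size w)%N ->
  blob_gen l1 l2 i.+1 (blob_gen l1 l2 i.+2 (blob_gen l1 l2 i.+1 y)) w =
  blob_gen l1 l2 i.+1 y w /\
  blob_gen l1 l2 i.+2 (blob_gen l1 l2 i.+1 (blob_gen l1 l2 i.+2 y)) w =
  blob_gen l1 l2 i.+2 y w.
Proof.
elim: i w y => [|i IH] [|a w] y // sw; last exact: IH.
case: w sw => [|b [|c w]] // _; case: a; case: b; case: c;
  by split; rewrite /= /mix /=; field.
Qed.

Lemma blob_gen_comm l1 l2 i j y w : (i.+1 < j)%N ->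
  blob_gen l1 l2 i (blob_gen l1 l2 j y) w =
  blob_gen l1 l2 j (blob_gen l1 l2 i y) w.
Proof.
case: i j => [|i] [|j] // ij; last by rewrite /= !exchE exch_comm //; ring.
case: j ij => // j _.
by rewrite /blob_gen !specht_XE !exchE specht_X_exch; ring.
Qed.

Lemma blob_gen0_sqr l1 l2 y w : (0 < size w)%N ->
  blob_gen l1 l2 0 (blob_gen l1 l2 0 y) w = (l2 - l1) * blob_gen l1 l2 0 y w.
Proof. by case: w => [|[] w] //= _; rewrite ?raisingE /=; ring. Qed.

(** A form y in the image of U_1 satisfies y_11 = y_22 = 0 and
    y_21 = - y_12 / q, and then E_(1/q) y_1 is y_12 on the words with first
    letter 1.  So U_0 y is a multiple of y_12 on the words 1 2 u and 2 1 u,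
    which are the only ones that U_1 sees. *)
Lemma blob_gen_101 l1 l2 y w : (1 < size w)%N ->
  blob_gen l1 l2 1 (blob_gen l1 l2 0 (blob_gen l1 l2 1 y)) w =
  (l1 * q^-1 - l2 * q) * blob_gen l1 l2 1 y w.
Proof.
case: w => [|a [|b w]] // _; case: a; case: b; rewrite /= /mix /=.
all: by rewrite ?raisingE ?invrK; field.
Qed.

(** * Moving the first letter to the end *)

Lemma foldl_exch_cons d m x b w :
  foldl (fun z i => exch d i z) x (iota 1 m) (b :: w) =
  foldl (fun z i => exch d i z) (fun v => x (b :: v)) (iota 0 m) w.
Proof.
by rewrite (iotaDl 1 0); elim: (iota 0 m) x => //= i s IH x.
Qed.

Lemma foldl_exch0_rcons m x u a : size u = m ->
  foldl (fun z i => exch (fun=> 0) i z) x (iota 0 m) (rcons u a) =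
  q ^+ count_mem a u * x (a :: u).
Proof.
elim: m u x => [|m IH] [|b u] x //= su; first by rewrite mul1r.
case: su => su; rewrite foldl_exch_cons IH //=.
by case: eqVneq => [->|_]; rewrite ?mul0r ?addr0 // exprS; ring.
Qed.

(** With the previous lemma, this says that T_n ... T_2 T_1 = theta varpi.  Each
    exchange passes the first letter across the next one: by the relations
    between E and the braiding, the slice of the result at any first letter is
    again of the form T_1 x', one letter shorter. *)
Lemma foldl_exch_T1_rcons l1 l2 m x u a : size u = m ->
  foldl (fun z i => exch (mix false) i z) (tensor_T1 l1 l2 x) (iota 0 m)
    (rcons u a) =
  (if a then l2 else l1) * (q ^+ count_mem a u * x (a :: u)).
Proof.
elim: m u x => [|m IH] [|b u] x //= su.
  by case: a => /=; ring.
case: su => su; rewrite foldl_exch_cons.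
(* The value of x' at the empty word is the one that exch takes on the
   one-letter word b. *)
pose x' v := if v is c :: v' then (if c == b then q else 1) * x (c :: b :: v')
             else q * tensor_T1 l1 l2 x [:: b].
rewrite (_ : (fun v => _) = tensor_T1 l1 l2 x'); last first.
  apply: functional_extensionality => -[|[] v] //=; case: b {IH} @x' => x' /=;
  by rewrite ?raisingE /mix /=; field.
by rewrite IH // /x' (eq_sym b); case: eqP => _ /=; rewrite ?exprS; ring.
Qed.

Lemma foldr_exch_cons d m x b :
  (fun w => foldr (exch d) x (iota 1 m) (b :: w)) =
  foldr (exch d) (fun v => x (b :: v)) (iota 0 m).
Proof. by rewrite (iotaDl 1 0); elim: (iota 0 m) => //= i s <-. Qed.

(** The value of X at the word 2 1^a 2^b, obtained from 1^a 2 2^b through the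
    conjugation of X by g_1, ..., g_a that defines X_(a+1).  The first exchange
    reduces the claim for [a + 1] to the one for [a] on the slice at 1, and
    for a = 0 the term with E vanishes as no letter 1 is left. *)
Lemma specht_X_foldr l1 l2 y a b :
  specht_X l1 l2 (foldr (exch (mix true)) y (iota 0 a))
    (true :: nseq a false ++ nseq b true) =
  l2 * y (nseq a false ++ true :: nseq b true).
Proof.
rewrite [LHS]/=; congr (_ * _).
elim: a y => [|a IH] y /=; first by rewrite raising_nseq_true; ring.
rewrite -(IH (fun v => y (false :: v))) -foldr_exch_cons raisingE.
by move: (foldr _ y _) => z; rewrite /mix /=; field.
Qed.

End Operators.

(** * The content of a word *)

(** The numbers of letters are integers so that they can be shifted down without
    conditions when a letter is removed. *)
Definition has_content (a b : int) (w : seq bool) : bool :=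
  ((count_mem false w)%:Z == a) && ((count_mem true w)%:Z == b).

Lemma has_content_false a b u :
  has_content a b (false :: u) = has_content (a - 1) b u.
Proof. rewrite /has_content /=; lia. Qed.

Lemma has_content_true a b u :
  has_content a b (true :: u) = has_content a (b - 1) u.
Proof. rewrite /has_content /=; lia. Qed.

Definition supported (k : fieldType) (a b : int) (x : seq bool -> k) : Prop :=
  forall w, ~~ has_content a b w -> x w = 0.

Section Support.
Variables (k : fieldType) (q : k).
Implicit Types (a b : int) (x : seq bool -> k).

Lemma supported_false a b x : supported a b x ->
  supported (a - 1) b (fun v => x (false :: v)).
Proof. by move=> sx w nw; apply: sx; rewrite has_content_false. Qed.

Lemma supported_true a b x : supported a b x ->
  supported a (b - 1) (fun v => x (true :: v)).
Proof. by move=> sx w nw; apply: sx; rewrite has_content_true. Qed.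

Lemma supported_raising p a b x : supported a b x ->
  supported (a + 1) (b - 1) (raising p x).
Proof.
move=> sx w; elim: w a b x sx => [|[] w IH] a b x sx //= nw.
  rewrite (IH a (b - 1) _ (supported_true sx)) ?mulr0 //.
  by rewrite -has_content_true.
rewrite (IH (a - 1) b _ (supported_false sx)) ?mulr0 ?add0r ?sx //.
  by move: nw; rewrite has_content_false has_content_true addrK.
by move: nw; rewrite has_content_false addrK subrK.
Qed.

Lemma supported_transition r a b x : supported a b x ->
  supported a b (transition r x).
Proof.
move=> sx w; elim: w a b x sx => [|[] w IH] a b x sx //= nw.
- exact: sx.
- have nw' : ~~ has_content a (b - 1) w by rewrite -has_content_true.
  rewrite (IH _ _ _ (supported_true sx)) // add0r.
  rewrite (IH a (b - 1)) ?mulr0 //.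
  by have := supported_raising r (supported_false sx); rewrite subrK.
- by rewrite (IH _ _ _ (supported_false sx)) // -has_content_false.
Qed.

Lemma supported_exch d i a b x : supported a b x ->
  supported a b (exch q d i x).
Proof.
move=> sx w; elim: i w a b x sx => [|i IH] [|c w] a b x sx nw /=;
  rewrite ?(sx _ nw) ?mulr0 //.
  case: w nw => [|c' w] nw //=.
  rewrite ?(sx _ nw) ?mulr0 addr0 (sx (c' :: c :: w)) ?if_same //.
  by move: nw; rewrite /has_content /=; lia.
case: c nw; rewrite ?has_content_true ?has_content_false => nw.
  exact: IH (supported_true sx) nw.
exact: IH (supported_false sx) nw.
Qed.

Lemma supported_T1 l1 l2 a b x : supported a b x ->
  supported a b (tensor_T1 q l1 l2 x).
Proof.
move=> sx [|[] w] nw /=; rewrite sx ?mulr0 //.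
have := supported_raising q (supported_false sx).
rewrite subrK => /(_ w) -> //; first by rewrite !mulr0 subr0.
by rewrite -has_content_true.
Qed.

Lemma supported_size (n : nat) a b x w : a + b = n -> supported a b x ->
  size w != n -> x w = 0.
Proof.
move=> abn sx; apply: contraNeq => xw0.
have /andP[/eqP c1 /eqP c2] : has_content a b w.
  by apply: contraNT xw0 => /sx ->.
rewrite -eqz_nat -abn -c1 -c2 -PoszD eqz_nat -(count_predC (pred1 false)).
by rewrite eqn_add2l; apply/eqP/eq_count => -[].
Qed.

End Support.

(** * Exchanging letters in words *)

Lemma nth_swapl i w j : (i.+1 < size w)%N ->
  nth false (swapl i w) j = nth false w (swapn i j).
Proof.
elim: i w j => [|i IH] [|a w] j //=.
  by case: w => [|b w] //; case: j => [|[|j]].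
rewrite ltnS => sw; case: j => [|j] //=; rewrite IH //.
by rewrite /swapn !eqSS; case: eqP => // _; case: eqP.
Qed.

Lemma size_swapl i w : size (swapl i w) = size w.
Proof. by elim: i w => [|i IH] [|a [|b w]] //=; rewrite IH. Qed.

Lemma swaplK i : involutive (swapl i).
Proof. by elim: i => [|i IH] [|a [|b w]] //=; rewrite IH. Qed.

Lemma bubble (A : seq bool -> Prop) a r :
  (forall i w, nth false w i = false -> nth false w i.+1 -> A w ->
     A (swapl i w)) ->
  A (nseq a false ++ true :: r) -> A (true :: nseq a false ++ r).
Proof.
elim: a A => [|a IH] A // step Aa.
apply: (step 0 (false :: true :: nseq a false ++ r)) => //.
apply: (IH (fun v => A (false :: v))) => // i w wi wi1 Aw.
exact: (step i.+1 (false :: w)).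
Qed.

(** The words 1^a 2^b generate all others by exchanges 1 2 -> 2 1.  As [A] is
    arbitrary, this can be applied to the part of a word behind its first
    letter, where the exchanges correspond to g_2, g_3, ... only. *)
Lemma word_ind (A : seq bool -> Prop) :
  (forall i w, nth false w i = false -> nth false w i.+1 -> A w ->
     A (swapl i w)) ->
  forall w,
    A (nseq (count_mem false w) false ++ nseq (count_mem true w) true) -> A w.
Proof.
move=> step w; elim: w A step => [|c w IH] A step //= Aw.
apply: (IH (fun v => A (c :: v))) => [i v|]; first exact: (step i.+1 (c :: v)).
by case: c Aw => //= Aw; apply: bubble.
Qed.

(** * Standard bitableaux as words *)

Section Tableaux.
Variables n1 n2 : nat.
Implicit Types t : bitableau n1 n2.

Definition word_of t : seq bool :=
  [seq i \notin row1 t | i <- iota 1 (n1 + n2)].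

Lemma size_word_of t : size (word_of t) = (n1 + n2)%N.
Proof. by rewrite size_map size_iota. Qed.

Lemma nth_word_of t i : (i < n1 + n2)%N ->
  nth false (word_of t) i = (i.+1 \notin row1 t).
Proof. by move=> iN; rewrite (nth_map 0%N) ?size_iota // nth_iota. Qed.

Lemma perm_rows t : perm_eq (row1 t ++ row2 t) (iota 1 (n1 + n2)).
Proof. by have /and3P[_ _] := valP t; rewrite map_cat. Qed.

Lemma uniq_rows t : uniq (row1 t ++ row2 t).
Proof. by rewrite (perm_uniq (perm_rows t)) iota_uniq. Qed.

Lemma row2E t i : i \in row2 t = (i \in iota 1 (n1 + n2)) && (i \notin row1 t).
Proof.
have := uniq_rows t; rewrite -(perm_mem (perm_rows t)) mem_cat cat_uniq.
case/and3P=> _ /hasPn dis _.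
by case i2: (i \in row2 t); rewrite ?orbT ?orbF ?andbN //= dis.
Qed.

Lemma row1_sub t i : i \in row1 t -> i \in iota 1 (n1 + n2).
Proof. by move=> i1; rewrite -(perm_mem (perm_rows t)) mem_cat i1. Qed.

Lemma has_content_word_of t : has_content n1 n2 (word_of t).
Proof.
have cnt b : count_mem b (word_of t) =
    count (fun i => (i \notin row1 t) == b) (row1 t ++ row2 t).
  by rewrite count_map; apply/esym/permP/perm_rows.
have sz1 : size (row1 t) = n1 by rewrite size_map size_tuple.
have sz2 : size (row2 t) = n2 by rewrite size_map size_tuple.
have c1 b : count (fun i => (i \notin row1 t) == b) (row1 t) = (n1 * ~~ b)%N.
  rewrite -[in RHS]sz1 (@eq_in_count _ _ (fun=> ~~ b)).
    by case: b; rewrite ?count_pred0 ?count_predT ?muln0 ?muln1.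
  by move=> i ->; case: b.
have c2 b : count (fun i => (i \notin row1 t) == b) (row2 t) = (n2 * b)%N.
  rewrite -[in RHS]sz2 (@eq_in_count _ _ (fun=> b)).
    by case: b; rewrite ?count_pred0 ?count_predT ?muln0 ?muln1.
  by move=> i; rewrite row2E => /andP[_ ->]; case: b.
by rewrite /has_content !cnt !count_cat !c1 !c2 /=; lia.
Qed.

Lemma word_of_inj : injective word_of.
Proof.
move=> t t' /eq_in_map tt'; have mem1 : row1 t =i row1 t'.
  move=> i; case iI: (i \in iota 1 (n1 + n2)).
    by apply: negb_inj; apply: tt'.
  by apply/idP/idP => /row1_sub; rewrite iI.
have mem2 : row2 t =i row2 t' by move=> i; rewrite !row2E mem1.
have /and3P[s1 s2 _] := valP t; have /and3P[s1' s2' _] := valP t'.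
have e1 := irr_sorted_eq ltn_trans ltnn s1 s1' mem1.
have e2 := irr_sorted_eq ltn_trans ltnn s2 s2' mem2.
apply/val_inj; case: (val t) (val t') e1 e2 => [r1 r2] [r1' r2'] /=.
by move=> /(inj_map val_inj)/val_inj -> /(inj_map val_inj)/val_inj ->.
Qed.

Lemma word_of_surj w : has_content n1 n2 w -> exists t, word_of t = w.
Proof.
case/andP => /eqP [c1] /eqP [c2].
have sw : size w = (n1 + n2)%N.
  rewrite -c1 -c2 -(count_predC (pred1 false)); congr addn.
  by apply: eq_count => -[].
pose r b := [seq i <- iota 1 (n1 + n2) | nth false w i.-1 == b].
have size_r b : size (r b) = count_mem b w.
  rewrite size_filter -{2}(mkseq_nth false w) count_map sw (iotaDl 1 0).
  rewrite count_map.
  exact: eq_count.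
pose s b := map (@inord (n1 + n2)) (r b).
have val_s b : map val (s b) = r b.
  rewrite -map_comp map_id_in // => i; rewrite mem_filter mem_iota.
  by move=> /and3P[_ _ iN] /=; rewrite inordK // -add1n.
have size1 : size (s false) == n1 by rewrite size_map size_r c1.
have size2 : size (s true) == n2 by rewrite size_map size_r c2.
have std : is_standard (Tuple size1, Tuple size2).
  rewrite /is_standard /= map_cat !val_s !sorted_filter ?iota_ltn_sorted //=;
    try exact: ltn_trans.
  have -> : r true = filter (predC (fun i => nth false w i.-1 == false))
                       (iota 1 (n1 + n2)).
    by apply: eq_filter => i /=; case: nth.
  by rewrite perm_filterC.
exists (Sub _ std); rewrite -[w in RHS](mkseq_nth false) sw /word_of /mkseq.
rewrite (iotaDl 1 0) -map_comp; apply/eq_in_map => i.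
rewrite mem_iota add0n => /= iN; rewrite /row1 SubK /= val_s mem_filter.
by rewrite mem_iota ltn_add2l iN andbT /=; case: nth.
Qed.

Lemma word_of_initial :
  word_of (initial_bitableau n1 n2) = nseq n1 false ++ nseq n2 true.
Proof.
have row1E : row1 (initial_bitableau n1 n2) = iota 1 n1.
  rewrite /row1 /= -map_comp (iotaDl 1 0) -val_enum_ord -map_comp.
  apply: eq_map => i /=; rewrite inordK // ltnS.
  exact: leq_trans (ltn_ord i) (leq_addr _ _).
apply: (@eq_from_nth _ false) => [|i].
  by rewrite size_word_of size_cat !size_nseq.
rewrite size_word_of => iN; rewrite nth_word_of // row1E mem_iota nth_cat.
rewrite size_nseq !nth_nseq if_same add1n ltnS /=.
by rewrite ltnS; case: ltnP => //= iN1; rewrite ltn_subLR ?iN.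
Qed.

Lemma word_of_swap i t : (i.+1 < n1 + n2)%N ->
  nth false (word_of t) i != nth false (word_of t) i.+1 ->
  word_of (swap_bitableau i.+1 t) = swapl i (word_of t).
Proof.
move=> iN; rewrite (nth_word_of t iN) (nth_word_of t (ltnW iN)) => sep.
have sw : (i.+1 < size (word_of t))%N by rewrite size_word_of.
apply: (@eq_from_nth _ false) => [|j].
  by rewrite size_swapl !size_word_of.
rewrite size_word_of => jN; rewrite nth_swapl // nth_word_of //.
have sN : (swapn i j < n1 + n2)%N by rewrite /swapn; do 2?case: eqP; lia.
rewrite nth_word_of // /row1 val_swap_bitableau //; last first.
  by move: sep; do 2!case: (_ \in _).
have -> : map val (map (@swap_entry _ i.+1) (val t).1) =
    map (swapn i.+1) (row1 t).
  rewrite -!map_comp; apply: eq_map => x /=; rewrite /swap_entry /swapn.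
  by case: eqP => _; [|case: eqP => _ //]; rewrite inordK // ltnS // ltnW.
rewrite -[j.+1 in LHS](swapnK i.+1) mem_map; last exact: inv_inj (swapnK _).
rewrite (_ : swapn i.+1 j.+1 = (swapn i j).+1) //.
by rewrite /swapn !eqSS; case: eqP => // _; case: eqP.
Qed.

End Tableaux.

(** * Linear forms on the Specht module *)

(** [scale_lfunE] for the scalar structures that occur in [is_blob_module], the
    one inferred for an opposite scalar being syntactically different. *)
Lemma hom_scaleE (k : fieldType) (V W : vectType k) (a : k) (f : 'Hom(V, W)) x :
  (a *: f) x = a *: f x.
Proof. exact: scale_lfunE. Qed.

Lemma hom_scaleNE (k : fieldType) (V W : vectType k) (a : k)
    (f : 'Hom(V, W)) x :
  (- a *: f) x = - a *: f x.
Proof. exact: scale_lfunE. Qed.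

Lemma bvec_sum (k : fieldType) (T : finType) (x : free_space k T) :
  x = \sum_t (x t : k) *: bvec k t.
Proof.
apply/ffunP => s; rewrite sum_ffunE (bigD1 s) //= !ffunE eqxx [_ *: _]mulr1.
by rewrite big1 ?addr0 // => t ts; rewrite !ffunE eq_sym (negbTE ts) scaler0.
Qed.

Lemma lin_extE (k : fieldType) (T : finType) (W : vectType k) (f : T -> W)
    (x : free_space k T) :
  lin_ext f x = \sum_t (x t : k) *: f t.
Proof.
rewrite {1}[x]bvec_sum linear_sum; apply: eq_bigr => t _.
by rewrite linearZ /= lin_ext_bvec.
Qed.

Lemma eq_on_bvec (k : fieldType) (T : finType) (W : vectType k)
    (f g : 'Hom(free_space k T, W)) :
  (forall t, f (bvec k t) = g (bvec k t)) -> f = g.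
Proof.
move=> fg; apply/lfunP => x; rewrite [x]bvec_sum !linear_sum.
by apply: eq_bigr => t _; rewrite !linearZ /= fg.
Qed.

Section SpechtDual.
Variables (k : fieldType) (q : k) (n1 n2 : nat).
Local Notation n := (n1 + n2)%N.
Local Notation g := (@specht_g k n1 n2 q).
Implicit Types (y : seq bool -> k) (t : bitableau n1 n2).

Definition functional (y : seq bool -> k) : 'Hom(specht_space k n1 n2, k^o) :=
  lin_ext (fun t => y (word_of t) : k^o).

Lemma functional_bvec y t : functional y (bvec k t) = y (word_of t).
Proof. exact: lin_ext_bvec. Qed.

Lemma functional_surj h : exists2 y, supported n1 n2 y & functional y = h.
Proof.
exists (fun w => \sum_(t | word_of t == w) h (bvec k t)).
  move=> w nw; rewrite big_pred0 // => t; apply: contraNF nw => /eqP <-.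
  exact: has_content_word_of.
apply: eq_on_bvec => t; rewrite functional_bvec (big_pred1 t) // => t'.
exact: (inj_eq (@word_of_inj n1 n2)).
Qed.

Lemma functional_inj y y' : supported n1 n2 y -> supported n1 n2 y' ->
  functional y = functional y' -> y = y'.
Proof.
move=> sy sy' e; apply: functional_extensionality => w.
have [/word_of_surj[t <-]|nw] := boolP (has_content n1 n2 w).
  by rewrite -!functional_bvec e.
by rewrite sy // sy'.
Qed.

Lemma functionalB a y y' :
  functional (fun w => y w - a * y' w) = functional y - a *: functional y'.
Proof.
apply: eq_on_bvec => t.
by rewrite add_lfunE opp_lfunE hom_scaleE !functional_bvec.
Qed.

Lemma functionalZ a y : functional (fun w => a * y w) = a *: functional y.
Proof.
by apply: eq_on_bvec => t; rewrite hom_scaleE !functional_bvec.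
Qed.

Lemma eq_functional y y' :
  (forall w, size w = n -> y w = y' w) -> functional y = functional y'.
Proof.
by move=> yy; apply: eq_on_bvec => t; rewrite !functional_bvec yy ?size_word_of.
Qed.

Lemma specht_g_bvec i t : g i (bvec k t) =
  if (i \in row1 t) == (i.+1 \in row1 t) then q *: bvec k t
  else if i \in row1 t then bvec k (swap_bitableau i t)
  else bvec k (swap_bitableau i t) + (q - q^-1) *: bvec k t.
Proof. exact: lin_ext_bvec. Qed.

Lemma specht_g_ascent i t : (i.+1 < n)%N ->
  nth false (word_of t) i = false -> nth false (word_of t) i.+1 ->
  g i.+1 (bvec k t) = bvec k (swap_bitableau i.+1 t).
Proof.
move=> iN; rewrite (nth_word_of t iN) (nth_word_of t (ltnW iN)) specht_g_bvec.
by move=> /negbFE -> /negbTE ->.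
Qed.

Lemma functional_g i y : (i.+1 < n)%N ->
  (functional y \o g i.+1)%VF = functional (exch q (mix q true) i y).
Proof.
move=> iN; apply: eq_on_bvec => t.
rewrite comp_lfunE functional_bvec exchP ?size_word_of //.
have := @word_of_swap n1 n2 i t iN.
rewrite (nth_word_of t iN) (nth_word_of t (ltnW iN)) specht_g_bvec.
rewrite (inj_eq negb_inj); case: eqP => [_ _|neq /(_ isT) <-].
  by rewrite linearZ /= functional_bvec.
case: ifP => _; rewrite ?linearD ?linearZ /= !functional_bvec /mix /=.
  by rewrite mul0r addr0.
by [].
Qed.

Lemma functional_gE i y x : (i.+1 < n)%N ->
  functional y (g i.+1 x) = functional (exch q (mix q true) i y) x.
Proof. by move=> iN; rewrite -functional_g // comp_lfunE. Qed.

Variables (m : int) (X : 'End(specht_space k n1 n2)).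
Hypotheses (q0 : q != 0) (n0 : (0 < n)%N) (hX : is_specht q m X).
Local Notation gen := (blob_gen q (lambda1 q m) (lambda2 q m)).

(** Read from right to left, X_(a+1) = g_a ... g_1 X g_1 ... g_a first moves the
    letter 2 to the front of the word; on linear forms, the remaining factors
    act on the value. *)
Lemma functional_jucys_murphy a y t t' r :
  word_of t = nseq a false ++ true :: r ->
  word_of t' = true :: nseq a false ++ r ->
  functional y (jucys_murphy X g a.+1 (bvec k t)) =
  functional (foldr (exch q (mix q true)) y (iota 0 a)) (X (bvec k t')).
Proof.
elim: a r y t => [|a IH] r y t wt wt'.
  by rewrite (@word_of_inj _ _ t t') ?wt.
have aN : (a.+1 < n)%N.
  by rewrite -(size_word_of t) wt size_cat size_nseq /= addnS ltnS leq_addr.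
have wta : nth false (word_of t) a = false.
  by rewrite wt nth_cat size_nseq ltnSn nth_nseq if_same.
have wta1 : nth false (word_of t) a.+1.
  by rewrite wt nth_cat size_nseq ltnn subnn.
have -> : iota 0 a.+1 = iota 0 a ++ [:: a] by rewrite -addn1 iotaD.
rewrite foldr_cat [jucys_murphy _ _ _]/= !comp_lfunE specht_g_ascent //.
rewrite functional_gE; last exact: aN.
apply: (IH (false :: r)).
  rewrite word_of_swap ?wta ?wta1 // wt.
  by elim: (a) => //= b ->.
by rewrite wt' -cat_rcons -cats1 -(nseqD a 1) addn1.
Qed.

(** The rules for X_1 and X_(n1+1) on the initial bitableau give X on the words
    c 1^a 2^b for both letters c, and [word_ind] extends this to all words with
    first letter c because X commutes with g_2, ..., g_(n-1). *)
Lemma functional_X y :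
  (functional y \o X)%VF =
  functional (specht_X q (lambda1 q m) (lambda2 q m) y).
Proof.
have [hecke JM1 JM2] := hX.
apply: eq_on_bvec => t; rewrite comp_lfunE functional_bvec.
pose A w := forall t, word_of t = w -> forall y, functional y (X (bvec k t)) =
  specht_X q (lambda1 q m) (lambda2 q m) y w.
suff : A (word_of t) by apply.
case wt: (word_of t) => [|c u].
  by move: (size_word_of t) n0; rewrite wt => <-.
apply: (@word_ind (fun v => A (c :: v))) => [i v vi vi1 Av t' wt' z|].
  have wt'' : word_of t' = swapl i.+1 (c :: v) by [].
  have iN : (i.+2 < n)%N.
    rewrite -(size_word_of t') wt'' size_swapl /= ltnS ltnNge.
    by apply: contraL vi1 => sv; rewrite nth_default.
  have sv : (i.+2 < size (c :: v))%N.
    by rewrite -(size_swapl i.+1) -wt'' size_word_of.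
  have [t1 wt1] : exists t1 : bitableau n1 n2, word_of t1 = c :: v.
    exists (swap_bitableau i.+2 t'); rewrite word_of_swap // ?wt'' ?swaplK //.
    by rewrite !nth_swapl // /swapn !eqxx /= eqn_leq ltnn /= vi vi1.
  have -> : bvec k t' = g i.+2 (bvec k t1).
    rewrite specht_g_ascent ?wt1 //; congr bvec; apply: word_of_inj.
    by rewrite word_of_swap ?wt1 //= vi vi1.
  rewrite -[X _]comp_lfunE (hecke_commX hecke) // comp_lfunE.
  rewrite functional_gE // (Av _ wt1) specht_X_exch // exchP //=.
  by rewrite vi vi1 /mix mul0r addr0.
have := has_content_word_of t; rewrite wt => /andP[/eqP[c1] /eqP[c2]].
case: c wt c1 c2 => /= wt c1 c2 t' wt' z.
- rewrite add0n in c1; rewrite c1 in wt' *; set b := count_mem true u.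
  have n2E : n2 = b.+1 by rewrite -c2 add1n.
  have wt0 : word_of (initial_bitableau n1 n2) =
      nseq n1 false ++ true :: nseq b true by rewrite word_of_initial n2E.
  (* The g_i are invertible, so it suffices to test X with the linear forms
     z' g_n1 ... g_1. *)
  have [z' <-] := foldr_exch_surj q0 true (iota 0 n1) z.
  rewrite specht_X_foldr // -(functional_jucys_murphy z' wt0 wt').
  rewrite JM2; last by rewrite addn1 ltnSn n2E addnS ltnS leq_addr.
  by rewrite linearZ /= functional_bvec wt0 subSnn subnn muln0 expr0 mulr1.
- have -> : t' = initial_bitableau n1 n2.
    by apply: word_of_inj; rewrite word_of_initial wt' -c2 add0n -c1 add1n.
  rewrite -[X]/(jucys_murphy X g 1) JM1 -?c1 // linearZ /= functional_bvec.
  by rewrite word_of_initial -c1 -c2 add0n add1n muln0 expr0 mulr1.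
Qed.

Lemma dual_specht_action y i : (i < n)%N ->
  dual_action (specht_action q m X) i (functional y) = functional (gen i y).
Proof.
move=> iN; apply/lfunP => x; rewrite dual_actionE; case: i iN => [|i] iN /=.
  rewrite functionalB -functional_X.
  by rewrite !(add_lfunE, opp_lfunE, hom_scaleE, comp_lfunE, id_lfunE)
    linearB linearZ.
rewrite functionalB -functional_g //.
by rewrite !(add_lfunE, opp_lfunE, hom_scaleE, comp_lfunE, id_lfunE)
    linearB linearZ.
Qed.

Hypothesis c0 : q - q^-1 != 0.

Lemma qint2 : - qint q 2 = - (q + q^-1).
Proof.
rewrite /qint; have -> : q ^ (- 2) = q^-1 ^+ 2 by rewrite exprVn.
by rewrite -[q ^ 2]/(q ^+ 2) subr_sqr mulrAC divff ?mul1r.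
Qed.

Lemma qint_lambda : - qint q m = lambda2 q m - lambda1 q m.
Proof. by rewrite /qint /lambda1 /lambda2 mulrBl opprB. Qed.

Lemma qint_pred : qint q (m - 1) = lambda1 q m * q^-1 - lambda2 q m * q.
Proof.
rewrite /qint /lambda1 /lambda2 opprB !expfzDr // expr1z exprN1.
by rewrite mulrBl mulrAC [q * _]mulrC [in X in _ - X]mulrAC.
Qed.

Lemma dual_specht_blob :
  is_blob_module n q m (dual_action (specht_action q m X)).
Proof.
(* D is made abstract so that unification does not unfold it. *)
move: (dual_action _) dual_specht_action => D DE.
split.
- move=> i j iN jN ij; apply/lfunP => h; have [y _ <-] := functional_surj h.
  case/andP: iN => i0 iN; case/andP: jN => j0 jN.
  rewrite !comp_lfunE !DE //; apply: eq_functional => w wn.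
  case: i i0 iN ij => // i _ iN; case: j j0 jN => // j _ jN.
  by case/orP => /eqP e; rewrite -e; apply blob_gen_TL => //; rewrite wn e.
- move=> i iN; apply/lfunP => h; have [y _ <-] := functional_surj h.
  case/andP: iN => i0 iN.
  rewrite comp_lfunE hom_scaleE !DE // -functionalZ.
  apply: eq_functional => w _; case: i i0 iN => // i _ _.
  by rewrite blob_gen_sqr // qint2.
- move=> _; apply/lfunP => h; have [y _ <-] := functional_surj h.
  rewrite comp_lfunE hom_scaleE !DE // -functionalZ.
  apply: eq_functional => w wn; rewrite blob_gen0_sqr ?wn //.
  by rewrite qint_lambda.
- move=> n1N; apply/lfunP => h; have [y _ <-] := functional_surj h.
  rewrite !comp_lfunE hom_scaleE !DE // -functionalZ.
  by apply: eq_functional => w wn; rewrite blob_gen_101 ?wn // qint_pred.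
- move=> i j iN jN ij; apply/lfunP => h; have [y _ <-] := functional_surj h.
  rewrite !comp_lfunE !DE //; apply: eq_functional => w _.
  by case/orP: ij => ij; [|symmetry]; apply: blob_gen_comm.
Qed.

End SpechtDual.

(** * Coefficients of tensors *)

Section Tensors.
Variables (k : fieldType) (q : k) (n : nat).
Implicit Types (x y : tensor_space k n) (w : word n) (s : seq bool).

(** The coefficients are extended by 0 to the words of all lengths, so that the
    operators on functions, which split off letters, apply to them. *)
Definition coef x s : k := oapp (fun w => x w : k) 0 (insub s).

Definition vec (f : seq bool -> k) : tensor_space k n :=
  [ffun w : word n => f w].

Lemma coef_word x w : coef x w = x w.
Proof. by rewrite /coef valK. Qed.

Lemma coef_size x s : size s != n -> coef x s = 0.
Proof. by move=> sn; rewrite /coef insubF //; apply/negbTE. Qed.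

Lemma coef_inj : injective coef.
Proof. by move=> x y xy; apply/ffunP => w; rewrite -!coef_word xy. Qed.

Lemma eq_coef x y : (forall s, size s = n -> coef x s = coef y s) -> x = y.
Proof. by move=> xy; apply/ffunP => w; rewrite -!coef_word xy ?size_tuple. Qed.

Lemma coef_linear a x y s : coef (a *: x + y) s = a * coef x s + coef y s.
Proof.
have [sn|sn] := eqVneq (size s) n; last by rewrite !coef_size // mulr0 addr0.
have [w <-] : exists w : word n, val w = s by exists (Tuple (introT eqP sn)).
by rewrite !coef_word !ffunE.
Qed.

Lemma coef_vec f s : size s = n -> coef (vec f) s = f s.
Proof. by move=> /eqP sn; rewrite -[s]/(val (Tuple sn)) coef_word ffunE. Qed.

Lemma coef_vec_supported (a b : int) f : a + b = n -> supported a b f ->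
  coef (vec f) = f.
Proof.
move=> abn sf; apply: functional_extensionality => s.
have [/coef_vec->//|sn] := eqVneq (size s) n.
by rewrite coef_size // (supported_size abn sf).
Qed.

Lemma put2_id i w : (i.+1 < n)%N ->
  put2 w i.+2 (letter w i.+1) (letter w i.+2) = w.
Proof.
move=> iN; apply: eq_from_tnth => j; rewrite tnth_mktuple /letter /=.
by rewrite !eqSS (tnth_nth false); case: eqP => [->|_] //; case: eqP => [->|].
Qed.

Definition swapw i w := put2 w i.+2 (letter w i.+2) (letter w i.+1).

Lemma val_swapw i w : (i.+1 < n)%N -> val (swapw i w) = swapl i w.
Proof.
move=> iN; apply: (@eq_from_nth _ false) => [|j].
  by rewrite size_swapl !size_tuple.
rewrite size_tuple => jN; rewrite nth_swapl ?size_tuple //.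
rewrite -[j]/(val (Ordinal jN)) -tnth_nth tnth_mktuple /letter /= !eqSS /swapn.
by rewrite (tnth_nth false); case: eqP => // _; case: eqP.
Qed.

Lemma swapwK i : (i.+1 < n)%N -> involutive (swapw i).
Proof. by move=> iN w; apply/val_inj; rewrite !val_swapw // swaplK. Qed.

Lemma exch_eq0 d i f s : (forall s', size s' = size s -> f s' = 0) ->
  exch q d i f s = 0 :> k.
Proof.
elim: i s f => [|i IH] [|a s] f f0 /=; rewrite ?f0 ?mulr0 //; last first.
  by apply: IH => s' ss'; apply: f0; rewrite /= ss'.
case: s f0 => [|b s] f0; first by rewrite ?f0 ?mulr0.
by rewrite ?f0 ?mulr0 ?addr0 ?if_same.
Qed.

(** The matrix of [A] in the basis of words is symmetric, so the coefficients of
    A x are found by applying [A] to the basis vectors. *)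
Lemma coef_exch d i (A : 'End(tensor_space k n)) x : (i.+1 < n)%N ->
  (forall w, A (bvec k w) =
     if letter w i.+1 == letter w i.+2 then q *: bvec k w
     else bvec k (swapw i w) + (d (letter w i.+1) : k) *: bvec k w) ->
  coef (A x) = exch q d i (coef x).
Proof.
move=> iN AE; apply: functional_extensionality => s.
have [sn|sn] := eqVneq (size s) n; last first.
  by rewrite coef_size // exch_eq0 // => s' ss'; rewrite coef_size ?ss'.
have [w <-] : exists w : word n, val w = s.
  by exists (Tuple (introT eqP sn)).
have Asym v : A (bvec k v) w = A (bvec k w) v.
  have [->//|vw] := eqVneq v w.
  have off (u u' : word n) : u != u' -> A (bvec k u) u' = (u' == swapw i u)%:R.
    move=> uu'; rewrite AE; case: eqP => [e|_].
      rewrite /swapw -e {2}e put2_id // !ffunE eq_sym (negbTE uu').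
      exact: scaler0.
    rewrite !ffunE [u' == u]eq_sym (negbTE uu').
    by rewrite [_ *: _]mulr0 addr0.
  rewrite !off // 1?eq_sym //; congr (_%:R).
  by rewrite -[w in LHS](swapwK iN) (inj_eq (inv_inj (swapwK iN))) eq_sym.
have pick (u : word n) : \sum_v x v * bvec k u v = x u.
  rewrite (bigD1 u) //= ffunE eqxx mulr1 big1 ?addr0 // => v vu.
  by rewrite ffunE (negbTE vu) mulr0.
rewrite coef_word exchP ?size_tuple // -val_swapw // !coef_word.
rewrite {1}[x]bvec_sum linear_sum sum_ffunE.
transitivity (\sum_v x v * A (bvec k w) v).
  by apply: eq_bigr => v _; rewrite linearZ /= ffunE Asym.
rewrite AE /letter /=; case: eqP => _.
  rewrite -pick mulr_sumr; apply: eq_bigr => v _.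
  by rewrite ffunE mulrCA.
rewrite -!pick mulr_sumr -big_split; apply: eq_bigr => v _ /=.
by rewrite !ffunE mulrDr; congr (_ + _); exact: mulrCA.
Qed.

Lemma coef_Top i x : (i.+1 < n)%N ->
  coef (Top n q i.+2 x) = exch q (mix q false) i (coef x).
Proof.
move=> iN; apply: coef_exch => // w.
rewrite lin_ext_bvec.
rewrite -(lin_extE (fun ab : bool * bool => bvec k (put2 w i.+2 ab.1 ab.2))).
rewrite /Rmap lin_ext_bvec /swapw /mix; have := put2_id w iN.
by case: (letter w i.+1); case: (letter w i.+2) => /= idw;
  rewrite ?linearD ?linearZ /= !lin_ext_bvec ?scale0r ?addr0 /= ?idw.
Qed.

Lemma coef_Sop i x : (i.+1 < n)%N ->
  coef (Sop n q i.+2 x) = exch q (fun=> 0) i (coef x).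
Proof.
move=> iN; apply: coef_exch => // w.
rewrite scale0r addr0; exact: lin_ext_bvec.
Qed.

Lemma coef_foldl_Top r x : all (fun i => i.+1 < n)%N r ->
  coef (foldl (fun y i => Top n q i.+2 y) x r) =
  foldl (fun f i => exch q (mix q false) i f) (coef x) r.
Proof. by elim: r x => //= i r IH x /andP[iN rN]; rewrite IH // coef_Top. Qed.

Lemma coef_Sop_prod f r x : all (fun i => i.+1 < n)%N r ->
  coef ((\big[(@comp_lfun _ _ _ _)/f]_(i <- rev r) Sop n q i.+2) x) =
  foldl (fun f i => exch q (fun=> 0) i f) (coef (f x)) r.
Proof.
elim: r f => [|i r IH] f; first by rewrite big_nil.
by case/andP=> iN rN; rewrite rev_cons big_rcons_op IH //= comp_lfunE coef_Sop.
Qed.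

Lemma mem_weight_space (n1 n2 : nat) x : (n1 + n2)%N = n ->
  (x \in weight_space k n (n1%:Z - n2%:Z)) <-> supported n1 n2 (coef x).
Proof.
move=> nE; have wE w : has_content n1 n2 w = (weight w == n1%:Z - n2%:Z).
  have : (count_mem false w + count_mem true w)%N = n.
    rewrite -[in RHS](size_tuple w) -(count_predC (pred1 false)).
    by congr addn; apply: eq_count => -[].
  by rewrite /has_content /weight; lia.
split=> [xM s ns | sx]; last first.
  rewrite [x]bvec_sum; apply: memv_suml => w _.
  have [wl|nw] := boolP (has_content n1 n2 w); last first.
    by rewrite -coef_word sx // scale0r mem0v.
  by apply/memvZ/memv_span/map_f; rewrite mem_filter -wE wl mem_enum.
have [sn|sn] := eqVneq (size s) n; last by rewrite coef_size.
have [w wE'] : exists w : word n, val w = s by exists (Tuple (introT eqP sn)).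
pose p : 'Hom(tensor_space k n, k^o) :=
  lin_ext (fun v : word n => (v == w)%:R : k^o).
have pE y : p y = y w.
  rewrite lin_extE (bigD1 w) //= eqxx [_ *: _]mulr1 big1 ?addr0 // => v.
  by move=> /negbTE ->; exact: scaler0.
have : x \in lker p.
  apply: subvP xM; apply/span_subvP => _ /mapP[v + ->].
  rewrite mem_filter -wE memv_ker pE ffunE => /andP[cv _].
  by case: (w =P v) => [vw|_]; [move: ns; rewrite -wE' vw cv | rewrite eqxx].
by rewrite memv_ker pE -wE' coef_word => /eqP.
Qed.

Hypothesis q0 : q != 0.

(** Injectivity comes from the quadratic relation T^2 = 1 + c T, which
    expresses v in terms of T v and T (T v). *)
Lemma lker_Top i : (i.+1 < n)%N -> lker (Top n q i.+2) == 0%VS.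
Proof.
move=> iN; apply/lker0P => x y xy; apply: coef_inj.
apply: functional_extensionality => s.
have := congr1 (fun f => f s) (exch_quad q0 false i (coef x)).
have := congr1 (fun f => f s) (exch_quad q0 false i (coef y)).
by rewrite -!coef_Top // xy => -> /addIr.
Qed.

Lemma Top_inv_foldl r x : all (fun i => i.+1 < n)%N r ->
  (\big[(@comp_lfun _ _ _ _)/(\1%VF)]_(i <- r) (Top n q i.+2)^-1)%VF
    (foldl (fun y i => Top n q i.+2 y) x r) = x.
Proof.
elim: r x => [|i r IH] x; first by rewrite big_nil id_lfunE.
by case/andP=> iN rN; rewrite big_cons comp_lfunE IH // lker0_lfunK ?lker_Top.
Qed.

Variable m : int.

Lemma coef_varpi x a s : size (a :: s) = n ->
  coef (varpi n q m x) (a :: s) =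
  (if a then lambda2 q m else lambda1 q m) * coef x (a :: s).
Proof.
move=> /eqP sn; rewrite -[a :: s]/(val (Tuple sn)) !coef_word.
rewrite lin_extE sum_ffunE (bigD1 (Tuple sn)) //= big1 => [|w nw].
  by rewrite !ffunE eqxx addr0 [_ *: 1]mulr1 mulrC.
by rewrite !ffunE eq_sym (negbTE nw) !scaler0.
Qed.

(** T_1 is defined with inverses of the T_i; multiplying by T_n ... T_2 removes
    them, and then both sides are the rotation of words with the same
    coefficients. *)
Lemma coef_T1op (a b : int) x :
  (0 < n)%N -> a + b = n -> supported a b (coef x) ->
  coef (T1op n q m x) = tensor_T1 q (lambda1 q m) (lambda2 q m) (coef x).
Proof.
move=> n0 abn sx; set f := tensor_T1 _ _ _ _.
have fE : coef (vec f) = f.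
  by apply: (coef_vec_supported abn); apply: supported_T1.
have rN : all (fun i => i.+1 < n)%N (iota 0 n.-1).
  by apply/allP => i; rewrite mem_iota; lia.
have iE : index_iota 2 n.+1 = map (addn 2) (iota 0 n.-1).
  by rewrite /index_iota -iotaDl addn0; congr iota; lia.
have E : (theta n q \o varpi n q m)%VF x =
    foldl (fun y i => Top n q i.+2 y) (vec f) (iota 0 n.-1).
  apply: eq_coef => s sn; rewrite coef_foldl_Top // fE comp_lfunE.
  rewrite /theta iE -map_rev big_map coef_Sop_prod // id_lfunE.
  case/lastP: s sn => [sn|u c sn].
    by exfalso; move: n0; rewrite -sn.
  have un : (size u).+1 = n by rewrite -(size_rcons u c) sn.
  have u1 : size u = n.-1 by rewrite -un.
  rewrite foldl_exch0_rcons // foldl_exch_T1_rcons // coef_varpi /= ?un //.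
  exact: mulrCA.
by rewrite -fE /T1op -comp_lfunA comp_lfunE E iE big_map Top_inv_foldl.
Qed.

End Tensors.

(** * The isomorphism *)

Lemma blob_module_pullback (k : fieldType) (n : nat) (q : k) (m : int)
    (W1 W2 : vectType k) (U1 : nat -> 'End(W1)) (U2 : nat -> 'End(W2))
    (f : 'Hom(W1, W2)) : injective f ->
  (forall i, (i < n)%N -> (f \o U1 i = U2 i \o f)%VF) ->
  is_blob_module n q m U2 -> is_blob_module n q m U1.
Proof.
move=> f_inj fU [UUU UU UU0 U101 UC].
have fUE i x : (i < n)%N -> f (U1 i x) = U2 i (f x).
  by move=> iN; rewrite -!comp_lfunE fU.
split.
- move=> i j iN jN ij; apply/lfunP => x; apply: f_inj.
  have /andP[_ iN'] := iN; have /andP[_ jN'] := jN.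
  by rewrite !comp_lfunE !fUE // -!comp_lfunE UUU.
- move=> i iN; apply/lfunP => x; apply: f_inj; have /andP[_ iN'] := iN.
  rewrite hom_scaleNE linearZ /= comp_lfunE !fUE // -comp_lfunE.
  by rewrite UU // hom_scaleNE.
- move=> n0; apply/lfunP => x; apply: f_inj.
  rewrite hom_scaleNE linearZ /= comp_lfunE !fUE // -comp_lfunE.
  by rewrite UU0 // hom_scaleNE.
- move=> n1; apply/lfunP => x; apply: f_inj; have n0 := ltnW n1.
  rewrite hom_scaleE linearZ /= !comp_lfunE !fUE // -!comp_lfunE.
  by rewrite U101 // !comp_lfunE hom_scaleE.
- move=> i j iN jN ij; apply/lfunP => x; apply: f_inj.
  by rewrite !comp_lfunE !fUE // -!comp_lfunE UC.
Qed.

Section Isomorphism.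
Variables (k : fieldType) (q : k) (m : int) (n1 n2 : nat).
Local Notation n := (n1 + n2)%N.
Local Notation M := (weight_space k n (n1%:Z - n2%:Z)).
Local Notation U := (tensor_action n q m).
Hypotheses (q0 : q != 0) (n0 : (0 < n)%N).

Lemma coef_action i x : (i < n)%N -> x \in M ->
  coef (U i x) =
  if i is i'.+1 then fun w => exch q (mix q false) i' (coef x) w - q * coef x w
  else fun w => tensor_T1 q (lambda1 q m) (lambda2 q m) (coef x) w
                - lambda1 q m * coef x w.
Proof.
move=> iN /(mem_weight_space x erefl) sx; apply: functional_extensionality => s.
case: i iN => [|i] iN /=;
  rewrite !(add_lfunE, opp_lfunE, scale_lfunE, id_lfunE);
  rewrite addrC -scaleNr coef_linear.
  by rewrite (coef_T1op q0 m n0 _ sx) //; ring.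
by rewrite coef_Top //; ring.
Qed.

Lemma weight_space_stable : is_stable n U M.
Proof.
move=> i iN; apply/subvP => _ /memv_imgP[x xM ->].
have sx := (mem_weight_space x erefl).1 xM.
apply/mem_weight_space => // w nw; rewrite coef_action //.
case: i {iN} => [|i]; rewrite (sx w nw) mulr0 subr0.
  exact: supported_T1 sx w nw.
exact: supported_exch sx w nw.
Qed.

Lemma transition_action i x : (i < n)%N -> x \in M ->
  transition q (coef (U i x)) =
  blob_gen q (lambda1 q m) (lambda2 q m) i (transition q (coef x)).
Proof.
move=> iN xM; rewrite coef_action //; case: i {iN} => [|i] /=;
  rewrite transitionD transitionN transitionZ.
  by rewrite transition_T1.
by rewrite transition_exch.
Qed.

Definition to_dual (x : tensor_space k n) : 'Hom(specht_space k n1 n2, k^o) :=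
  functional n1 n2 (transition q (coef x)).

Lemma to_dual_linear : linear to_dual.
Proof.
move=> a x y; apply: eq_on_bvec => t.
rewrite add_lfunE scale_lfunE !functional_bvec.
rewrite (_ : coef _ = fun w => a * coef x w + coef y w).
  by rewrite transitionD transitionZ.
by apply: functional_extensionality => w; rewrite coef_linear.
Qed.

HB.instance Definition _ := GRing.isLinear.Build _ _ _ _ to_dual to_dual_linear.

Definition iso : 'Hom(subvs_of M, 'Hom(specht_space k n1 n2, k^o)) :=
  (linfun to_dual \o linfun vsval)%VF.

Lemma isoE x : iso x = to_dual (vsval x).
Proof. by rewrite comp_lfunE !lfunE. Qed.

Lemma iso_inj : injective iso.
Proof.
move=> x y; rewrite !isoE => /functional_inj e; apply/val_inj/coef_inj.
have sup (z : subvs_of M) : supported n1 n2 (transition q (coef (vsval z))).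
  by apply/supported_transition/mem_weight_space => //; apply: subvsP.
by rewrite -(transitionK (coef _) q0) -[RHS](transitionK (coef _) q0) e.
Qed.

Lemma iso_surj h : h \in limg iso.
Proof.
have [y sy <-] := functional_surj h.
have sz : supported n1 n2 (transition q^-1 y) by apply: supported_transition.
pose z := vec n (transition q^-1 y).
have zE : coef z = transition q^-1 y by apply: coef_vec_supported sz.
have zM : z \in M by apply/mem_weight_space; rewrite ?zE.
have -> : functional n1 n2 y = iso (vsproj M z).
  by rewrite isoE /to_dual vsprojK // zE -{1}(invrK q) transitionK ?invr_eq0.
exact/memv_img/memvf.
Qed.

Lemma iso_action X i : is_specht q m X -> (i < n)%N ->
  (iso \o sub_action U M i = dual_action (specht_action q m X) i \o iso)%VF.
Proof.
move=> hX iN; apply/lfunP => x.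
rewrite [LHS]comp_lfunE [RHS]comp_lfunE !isoE /to_dual.
rewrite (dual_specht_action q0 n0 hX) // sub_actionE.
  by rewrite transition_action // subvsP.
exact: weight_space_stable.
Qed.

End Isomorphism.

Theorem theorem6 (k : closedFieldType) (q : k) (m : int) (n n1 n2 : nat)
  (hq0 : q != 0) (hq4 : q ^+ 4 != 1)
  (hl : lambda1 q m != lambda2 q m)
  (hl2 : lambda1 q m != q ^+ 2 * lambda2 q m)
  (hn : (0 < n)%N) (hn12 : (n1 + n2)%N = n)
  (X : 'End(specht_space k n1 n2)) (hX : is_specht q m X) :
  let M := weight_space k n (n1%:Z - n2%:Z) in
  is_stable n (tensor_action n q m) M /\
  blob_isomorphic n q m
    (sub_action (tensor_action n q m) M)
    (dual_action (specht_action q m X)).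
Proof.
move=> /=; subst n.
have c0 : q - q^-1 != 0.
  apply: contra hq4; rewrite subr_eq0 => /eqP e; apply/eqP.
  have q2 : q ^+ 2 = 1 by rewrite expr2 {1}e mulVf.
  by rewrite (exprM q 2 2) q2 expr1n.
have inj := @iso_inj _ _ n1 n2 hq0.
have isoU i := iso_action hq0 hn (i := i) hX.
have dual_blob := dual_specht_blob hq0 hn hX c0.
split; first exact: weight_space_stable.
split=> //; first exact: blob_module_pullback inj isoU dual_blob.
exists (iso q n1 n2); split=> //; exists ((iso q n1 n2)^-1)%VF => x.
  by rewrite lker0_lfunK //; apply/lker0P.
exact/limg_lfunVK/iso_surj.
Qed.
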